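(* Let $\mathfrak i=(\mathbf K,\perp)$ be an independence relation. Let $R$ be a (possibly strict) partial order on $\mathbf K$ which is stronger than $\le_{\mathbf K}$ (that is, $M\,R\,N$ implies $M\le_{\mathbf K}N$). If $\kappa^{\mathrm{cont}}(\mathfrak i,R)=\aleph_0$ (i.e. $\underline\kappa^{\mathrm{cont}}(\mathfrak i,R)$ contains all the regular cardinals), then $\underline\kappa(\mathfrak i,R)=\underline\kappa^{\mathrm{wk}}(\mathfrak i,R)$ and both are end segments of regular cardinals.
   Context: An abstract class is a partial order $\mathbf K=(K,\le_{\mathbf K})$ with $K$ a class of structures in a fixed vocabulary, closed (together with $\le_{\mathbf K}$) under isomorphisms, such that $M\le_{\mathbf K}N$ implies $M\subseteq N$. It is coherent if $M_0\subseteq M_1\le_{\mathbf K}M_2$ and $M_0\le_{\mathbf K}M_2$ imply $M_0\le_{\mathbf K}M_1$. $\mathrm{gS}(B;N)$ is the set of Galois (orbital) types over the set $B\subseteq|N|$ of elements of $N$ ($\mathrm{gtp}(b_1/B;N_1)=\mathrm{gtp}(b_2/B;N_2)$ is the transitive closure of: there are $N$ and embeddings $f_\ell:N_\ell\to N$ fixing $B$ with $f_1(b_1)=f_2(b_2)$). **Independence relation.** A pair $\mathfrak i=(\mathbf K,\perp)$ where $\mathbf K$ is a coherent abstract class with amalgamation and $\perp$ is a 4-ary relation, $\perp(M,A,B,N)$ also written $A\perp^N_M B$, implying $M\le_{\mathbf K}N$, $A,B\subseteq|N|$, $|A|\le1$, and satisfying: - invariance (preserved by isomorphisms); - monotonicity: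 if $A\perp^N_M B$, then $A_0\perp^N_M B_0$ for $A_0\subseteq A$, $B_0\subseteq B$; $A\perp^{N'}_M B$ for $N'\ge_{\mathbf K}N$; and $A\perp^{N_0}_M B$ whenever $M\le_{\mathbf K}N_0\le_{\mathbf K}N$ and $A\cup B\subseteq|N_0|$; - normality: $A\perp^N_M B$ implies $(A\cup|M|)\perp^N_M(B\cup|M|)$ (size of the left side counted modulo $|M|$); - base monotonicity: if $A\perp^N_{M_0}B$, $M_0\le_{\mathbf K}M\le_{\mathbf K}N$ and $|M|\subseteq B$, then $A\perp^N_M B$. A type $p\in\mathrm{gS}(B;N)$ does not fork over $M$ if $\{a\}\perp^N_M B$ for some (equivalently any) $a$ realizing $p$ in $N$. **Locality cardinals.** Consider an $R$-increasing chain $\langle M_i:i<\chi\rangle$ (i.e. $M_i\,R\,M_j$ for all $i<j<\chi$), $N\in\mathbf K$ with $M_i\le_{\mathbf K}N$ for all $i<\chi$, and $p\in\mathrm{gS}(\bigcup_{i<\chi}|M_i|;N)$. - $\underline\kappa(\mathfrak i,R)$: the class of regular $\chi$ such that for all such data there is $i<\chi$ such that $p$ does not fork over $M_i$. - $\underline\kappa^{\mathrm{wk}}(\mathfrak i,R)$: the class of regular $\chi$ such that for all such data there is $i<\chi$ such that $p\restriction M_{i+1}$ does not fork over $M_i$. - $\underline\kappa^{\mathrm{cont}}(\mathfrak i,R)$: the class of regular $\chi$ such that for all such data, if $p\restriction M_i$ does not fork over $M_0$ for all $i<\chi$, then $p$ does not fork over $M_0$. $\kappa^{\mathrm{cont}}(\mathfrak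 i,R)$ (not underlined) is the least regular $\chi\in\underline\kappa^{\mathrm{cont}}(\mathfrak i,R)$ such that every regular $\chi'>\chi$ is in $\underline\kappa^{\mathrm{cont}}(\mathfrak i,R)$. A class $S$ of regular cardinals is an end segment if $\chi_0\in S$ and $\chi_1>\chi_0$ regular imply $\chi_1\in S$. *)

(* Defs.v *)
From Stdlib Require Relation_Operators.
From mathcomp Require Import all_boot.
From mathcomp Require Import boolp classical_sets functions cardinality.
From mathcomp Require wochoice.

Set Implicit Arguments.
Unset Strict Implicit.
Unset Printing Implicit Defensive.

Local Open Scope classical_set_scope.
Local Open Scope card_scope.

(* A regular cardinal is presented by a well-ordered type whose order type is
   an initial ordinal equal to its own cofinality. A class of regular cardinals
   is a [set regular_cardinal]; isomorphic presentations denote the same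
   cardinal, and cardinals are compared by cardinality of the carriers. *)

(* The strict order of a total order [le]. *)
Definition strict_of (T : Type) (le : rel T) (i j : T) : Prop := ~~ le j i.

Definition cofinal_in (T : Type) (le : rel T) (X : set T) : Prop :=
  forall i, exists2 j, X j & le i j.

Record regular_cardinal := RegularCardinal {
  rc_sort :> Type;
  rc_le : rel rc_sort;
  rc_wo : wochoice.well_order rc_le;
  rc_infinite : infinite_set [set: rc_sort];
  rc_initial :
    forall i, ~ ([set: rc_sort] #<= [set j | strict_of rc_le j i]);
  rc_regular :
    forall X : set rc_sort, cofinal_in rc_le X -> [set: rc_sort] #<= X
}.

Definition rc_lt (chi : regular_cardinal) : chi -> chi -> Prop :=
  strict_of (@rc_le chi).

Definition is_succ (chi : regular_cardinal) (i j : chi) : Prop :=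
  rc_lt i j /\ forall k, rc_lt i k -> rc_le j k.

Definition cardinal_le (chi chi' : regular_cardinal) : Prop :=
  [set: chi] #<= [set: chi'].

Definition cardinal_lt (chi chi' : regular_cardinal) : Prop :=
  cardinal_le chi chi' /\ ~ cardinal_le chi' chi.

Definition end_segment (S : set regular_cardinal) : Prop :=
  forall chi0 chi1, S chi0 -> cardinal_lt chi0 chi1 -> S chi1.

Lemma nat_well_order : wochoice.well_order leq.
Proof.
move=> A [n An].
have exA : exists n, n \in A by exists n.
exists (ex_minn exA); split.
  by case: ex_minnP => m Am min_m; split.
case: ex_minnP => m Am min_m k [Ak min_k].
by apply/eqP; rewrite eqn_leq min_m // min_k.
Qed.

Lemma nat_initial (i : nat) : ~ ([set: nat] #<= [set j | strict_of leq j i]).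
Proof.
move=> le_nat; apply: infinite_nat; apply: card_le_finite le_nat _.
have -> : [set j | strict_of leq j i] = `I_i.
  by apply/seteqP; split=> j /=; rewrite /strict_of ltnNge.
exact: finite_II.
Qed.

Lemma nat_regular (X : set nat) : cofinal_in leq X -> [set: nat] #<= X.
Proof.
move=> cofX; apply/infiniteP => finX.
have [m ubm] : exists m, forall j, X j -> j <= m.
  have /finite_seqP [s Xs] := finX.
  exists (\max_(j <- s) j) => j; rewrite Xs /= => js.
  exact: (@leq_bigmax_seq _ s predT id).
by have [j Xj] := cofX m.+1; rewrite ltnNge ubm.
Qed.

Definition aleph0 : regular_cardinal :=
  RegularCardinal nat_well_order infinite_nat nat_initial nat_regular.

(* Arities are arbitrary types, so both finitary and infinitary vocabularies
   are covered. *)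
Record vocabulary := Vocabulary {
  fsym : Type;
  rsym : Type;
  far : fsym -> Type;
  rar : rsym -> Type
}.

(* The universe of a structure is a subset of an ambient type [V], which plays
   the role of the class of all sets: this gives a literal meaning to inclusions
   between structures, unions of chains, and maps fixing a set pointwise.
   Interpretations live on the universe itself, so that two structures are
   equal exactly when they have the same universe and interpretations. *)
Record structure (V : Type) (tau : vocabulary) := Structure {
  univ :> set V;
  fint : forall f : fsym tau, (far f -> univ) -> univ;
  rint : forall r : rsym tau, (rar r -> univ) -> Prop
}.

Section Structures.
Context {V : Type} {tau : vocabulary}.
Implicit Types M N : structure V tau.

Definition embedding M N (f : M -> N) : Prop :=
  [/\ injective f,
      forall s (t : far s -> M), f (fint t) = fint (f \o t) &
      forall r (t : rar r -> M), rint t <-> rint (f \o t)].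

Definition isomorphism M N (f : M -> N) : Prop :=
  embedding f /\ forall y, exists x, f x = y.

Definition substructure M N : Prop :=
  exists2 f : M -> N, embedding f & forall x, val (f x) = val x.

Definition extends M N M' N' (f : N -> N') (g : M -> M') : Prop :=
  forall (x : M) (y : N), val x = val y -> val (g x) = val (f y).

Definition fixes M N (B : set V) (f : M -> N) : Prop :=
  forall x : M, B (val x) -> val (f x) = val x.

Definition image_of M N (f : M -> N) (A : set V) : set V :=
  [set val (f x) | x in [set x : M | A (val x)]].

End Structures.

Record abstract_class (V : Type) (tau : vocabulary) := AbstractClass {
  ac_in :> structure V tau -> Prop;
  ac_le : structure V tau -> structure V tau -> Prop;
  ac_le_in : forall M N, ac_le M N -> ac_in M /\ ac_in N;
  ac_le_refl : forall M, ac_in M -> ac_le M M;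
  ac_le_anti : forall M N, ac_le M N -> ac_le N M -> M = N;
  ac_le_trans : forall M N P, ac_le M N -> ac_le N P -> ac_le M P;
  ac_in_iso : forall (M M' : structure V tau) (f : M -> M'), isomorphism f -> ac_in M -> ac_in M';
  ac_le_iso : forall (M N M' N' : structure V tau) (f : N -> N') (g : M -> M'),
    isomorphism f -> isomorphism g -> extends f g -> ac_le M N -> ac_le M' N';
  ac_le_sub : forall M N, ac_le M N -> substructure M N
}.

Section AbstractClasses.
Context {V : Type} {tau : vocabulary} (K : abstract_class V tau).
Implicit Types (M N : structure V tau) (A B : set V).

Definition coherent : Prop :=
  forall M0 M1 M2,
    substructure M0 M1 -> ac_le K M1 M2 -> ac_le K M0 M2 -> ac_le K M0 M1.

(* [f] is an isomorphism onto some [M'] with [M' <=_K N]. *)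
Definition K_embedding M N (f : M -> N) : Prop :=
  [/\ K M, K N &
      exists M' (g : M -> M'),
        [/\ isomorphism g, ac_le K M' N & forall x, val (g x) = val (f x)]].

Definition amalgamation : Prop :=
  forall M0 M1 M2, ac_le K M0 M1 -> ac_le K M0 M2 ->
    exists N (f1 : M1 -> N) (f2 : M2 -> N),
      [/\ K_embedding f1, K_embedding f2, fixes M0 f1 & fixes M0 f2].

Definition pointed : Type := {N : structure V tau & N}.

Definition gtp_atomic B (q1 q2 : pointed) : Prop :=
  [/\ B `<=` projT1 q1, B `<=` projT1 q2 &
      exists N (f1 : projT1 q1 -> N) (f2 : projT1 q2 -> N),
        [/\ K_embedding f1, K_embedding f2, fixes B f1, fixes B f2 &
            f1 (projT2 q1) = f2 (projT2 q2)]].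

Definition gtp_equiv B : pointed -> pointed -> Prop :=
  Relation_Operators.clos_trans pointed (gtp_atomic B).

(* Galois types over [B] are the equivalence classes of [gtp_equiv B]. *)
Definition gtp B N (b : N) : set pointed :=
  [set q | gtp_equiv B (existT (fun N : structure V tau => N : Type) N b) q].

Definition gS B N : set (set pointed) := [set p | exists b : N, p = gtp B b].

(* If [p] is the type of [b] in [N] over some superset of [B], this is the type
   of [b] in [N] over [B]. *)
Definition gtp_restrict (p : set pointed) B : set pointed :=
  [set q | exists2 q0, p q0 & gtp_equiv B q0 q].

End AbstractClasses.

(* The left-hand side of [indep] has at most one element modulo the base, which
   is the reading of [|A| <= 1] under which normality makes sense. *)
Record independence_relation (V : Type) (tau : vocabulary) := IndependenceRel {
  ir_class : abstract_class V tau;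
  ir_coherent : coherent ir_class;
  ir_amalgamation : amalgamation ir_class;
  indep : structure V tau -> set V -> set V -> structure V tau -> Prop;
  indep_dom : forall M A B N, indep M A B N ->
    [/\ ac_le ir_class M N, A `<=` N, B `<=` N & is_subset1 (A `\` M)];
  indep_invariance :
    forall (M : structure V tau) A B (N M' N' : structure V tau) (f : N -> N') (g : M -> M'),
      isomorphism f -> isomorphism g -> extends f g ->
      indep M A B N -> indep M' (image_of f A) (image_of f B) N';
  indep_mono_sets : forall M A B N A0 B0,
    A0 `<=` A -> B0 `<=` B -> indep M A B N -> indep M A0 B0 N;
  indep_mono_up : forall M A B N N',
    ac_le ir_class N N' -> indep M A B N -> indep M A B N';
  indep_mono_down : forall M A B N N0,
    ac_le ir_class M N0 -> ac_le ir_class N0 N -> A `|` B `<=` N0 ->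
    indep M A B N -> indep M A B N0;
  indep_normality : forall M A B N,
    indep M A B N -> indep M (A `|` M) (B `|` M) N;
  indep_base_mono : forall M0 M A B N,
    ac_le ir_class M0 M -> ac_le ir_class M N -> (M : set V) `<=` B ->
    indep M0 A B N -> indep M A B N
}.

Section Locality.
Context {V : Type} {tau : vocabulary} (i : independence_relation V tau).
Let K := ir_class i.
Implicit Types (M N : structure V tau) (R : structure V tau -> structure V tau -> Prop).

(* Non-forking over [M] of a type [p] in [gS B N]. *)
Definition dnf (B : set V) N (p : set (pointed (V := V) (tau := tau))) M : Prop :=
  exists2 a : N, p = gtp K B a & indep i M [set val a] B N.

Definition strict_or_weak_porder R : Prop :=
  [/\ forall M N, R M N -> K M /\ K N,
      forall M N P, R M N -> R N P -> R M P &
      (forall M, K M -> R M M) /\ (forall M N, R M N -> R N M -> M = N)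
      \/ (forall M, ~ R M M)].

Definition increasing_chain R (chi : regular_cardinal)
    (Mc : chi -> structure V tau) : Prop :=
  forall j k : chi, rc_lt j k -> R (Mc j) (Mc k).

Definition chain_union (chi : regular_cardinal)
    (Mc : chi -> structure V tau) : set V :=
  \bigcup_(j in [set: chi]) (Mc j : set V).

Definition locality_data R (chi : regular_cardinal)
    (Mc : chi -> structure V tau) N (p : set (pointed (V := V) (tau := tau))) : Prop :=
  [/\ increasing_chain R Mc, K N, forall j, ac_le K (Mc j) N &
      gS K (chain_union Mc) N p].

(* The classes [ukappa*] are the underlined kappas; [kappa_cont_is] below is the
   non-underlined cardinal. *)
Definition ukappa R : set regular_cardinal :=
  [set chi | forall Mc N p, @locality_data R chi Mc N p ->
     exists j : chi, dnf (chain_union Mc) N p (Mc j)].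

Definition ukappa_wk R : set regular_cardinal :=
  [set chi | forall Mc N p, @locality_data R chi Mc N p ->
     exists j k : chi, is_succ j k /\
       dnf (Mc k) N (gtp_restrict K p (Mc k)) (Mc j)].

Definition ukappa_cont R : set regular_cardinal :=
  [set chi | forall Mc N p, @locality_data R chi Mc N p ->
     forall zero : chi, (forall j, rc_le zero j) ->
       (forall j, dnf (Mc j) N (gtp_restrict K p (Mc j)) (Mc zero)) ->
       dnf (chain_union Mc) N p (Mc zero)].

Definition cont_from R (chi : regular_cardinal) : Prop :=
  ukappa_cont R chi /\
  forall chi', cardinal_lt chi chi' -> ukappa_cont R chi'.

(* [kappa^cont(i, R) = chi], as a relation since such a cardinal need not exist. *)
Definition kappa_cont_is R (chi : regular_cardinal) : Prop :=
  cont_from R chi /\ forall chi', cont_from R chi' -> cardinal_le chi chi'.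

End Locality.

(* Main.v *)
From Stdlib Require Relation_Operators.
From mathcomp Require Import all_boot.
From mathcomp Require Import boolp classical_sets functions cardinality.
Require Import Defs.

Set Implicit Arguments.
Unset Strict Implicit.
Unset Printing Implicit Defensive.

Local Open Scope classical_set_scope.
Local Open Scope card_scope.

(** Everything is obtained by passing to subchains. If [f : chi' -> chi] is
    strictly increasing, the chain [Mc \o f] is again [R]-increasing, and the
    type of an element [a] over its union is again locality data. Regularity
    supplies as many such [f] as needed ([climbing]): as long as [chi' <= chi],
    the values chosen before stage [k] are too few to be cofinal in [chi], so
    [f k] can be taken above all of them, and even above any [g j (f j)] chosen
    for [j < k]. The chains are not assumed continuous, so limit stages cost
    nothing.

    The inclusion of [ukappa] in [ukappa_wk] is monotonicity. For the converse,
    suppose that [p], the type of [a], forks over every [Mc j]. Continuity for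
    all regular cardinals yields, for each [j], some [g j >= j] such that already
    the type of [a] over [Mc (g j)] forks over [Mc j] ([cont_eventual_dnf]). Let
    [f] climb past [g]. In the chain [Mc \o f], each type over the successor
    stage [f k] extends one over [Mc (g (f j))], hence forks over [Mc (f j)]:
    the cardinal is not in [ukappa_wk].

    That [ukappa_wk] is an end segment is seen in the same way: a chain of length
    [chi] contains one of length [chi0 < chi], and a place [j < k] where the type
    over the [k]-th model of the subchain does not fork over the [j]-th is also
    good for the original chain, because the successor of [f j] is at most [f k].

    Non-forking of a type asserts that some realization is independent; the
    arguments above only shrink the set or enlarge the base, and both operations
    keep the realization ([dnf_subset], [dnf_base_mono]). *)

(** * Well-orders and climbing maps between regular cardinals *)

Section RegularCardinals.
Implicit Types chi : regular_cardinal.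

Lemma rc_min chi (S : set chi) :
  S !=set0 -> exists2 m, S m & forall x, S x -> rc_le m x.
Proof.
move=> [x Sx].
have [|m [[/asboolP Sm minm] _]] := @rc_wo chi (fun y => `[< S y >]).
  by exists x; apply/asboolP.
by exists m => // y Sy; apply: minm; apply/asboolP.
Qed.

Lemma rc_le_total chi (x y : chi) : rc_le x y \/ rc_le y x.
Proof.
have [|m Sm minm] := @rc_min chi [set z | z = x \/ z = y]; first by exists x; left.
by case: Sm => Em; rewrite Em in minm; [left|right]; apply: minm; [right|left].
Qed.

Lemma rc_le_refl chi (x : chi) : rc_le x x.
Proof. by case: (rc_le_total x x). Qed.

Lemma rc_le_anti chi (x y : chi) : rc_le x y -> rc_le y x -> x = y.
Proof.
move=> xy yx.
have [|m [_ uniqm]] := @rc_wo chi (fun z => `[< z = x \/ z = y >]).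
  by exists x; apply/asboolP; left.
rewrite -(uniqm x) ?(uniqm y) //; split; try (by apply/asboolP; left + right);
  by move=> z /asboolP[] ->; rewrite ?rc_le_refl.
Qed.

Lemma rc_ltNge chi (x y : chi) : rc_lt x y <-> ~ rc_le y x.
Proof. by split=> /negP. Qed.

Lemma rc_ltW chi (x y : chi) : rc_lt x y -> rc_le x y.
Proof. by move/rc_ltNge => nyx; case: (rc_le_total x y). Qed.

Lemma rc_le_trans chi (x y z : chi) : rc_le x y -> rc_le y z -> rc_le x z.
Proof.
move=> xy yz.
have [|m Sm minm] := @rc_min chi [set t | [\/ t = x, t = y | t = z]].
  by exists x; constructor 1.
have mx : rc_le m x by apply: minm; constructor 1.
have my : rc_le m y by apply: minm; constructor 2.
have mz : rc_le m z by apply: minm; constructor 3.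
case: Sm => Em; rewrite -{}Em in xy yz *.
- by [].
- by rewrite (rc_le_anti xy mx).
- by rewrite -(rc_le_anti yz my).
Qed.

Lemma rc_le_lt_trans chi (x y z : chi) : rc_le x y -> rc_lt y z -> rc_lt x z.
Proof.
by move=> xy /rc_ltNge nzy; apply/rc_ltNge => zx; apply: nzy; apply: rc_le_trans zx xy.
Qed.

Lemma rc_lt_le_trans chi (x y z : chi) : rc_lt x y -> rc_le y z -> rc_lt x z.
Proof.
by move=> /rc_ltNge nyx yz; apply/rc_ltNge => zx; apply: nyx; apply: rc_le_trans yz zx.
Qed.

Lemma rc_le_eqVlt chi (x y : chi) : rc_le x y -> x = y \/ rc_lt x y.
Proof.
by move=> xy; have [/(rc_le_anti xy)|/rc_ltNge] := pselect (rc_le y x); [left|right].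
Qed.

Lemma rc_lt_wf chi : well_founded (@rc_lt chi).
Proof.
move=> x; apply: contrapT => nAx.
have [|m nAm minm] := @rc_min chi [set y | ~ Acc (@rc_lt chi) y]; first by exists x.
by apply: nAm; constructor => y /rc_ltNge nmy; apply: contrapT => /minm.
Qed.

Lemma rc_bounded chi (X : set chi) :
  ~ ([set: chi] #<= X) -> exists b, forall x, X x -> rc_lt x b.
Proof.
move=> smallX; apply: contrapT => unbounded; apply/smallX/rc_regular => b.
apply: contrapT => Xltb; apply: unbounded; exists b => x Xx.
by apply/rc_ltNge => bx; apply: Xltb; exists x.
Qed.

Lemma rc_no_max chi (x : chi) : exists y, rc_lt x y.
Proof.
have [|b xb] := @rc_bounded chi [set x]; last by exists b; apply: xb.
by move=> /card_le_finite/(_ (finite_set1 _)); apply: rc_infinite.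
Qed.

Lemma rc_inhabited chi : exists c : chi, True.
Proof. by have /infinite_setN0[c _] := @rc_infinite chi; exists c. Qed.

Lemma rc_succ chi (x : chi) : exists y, is_succ x y.
Proof. by have [y xy miny] := rc_min (rc_no_max x); exists y. Qed.

(** Transfinite recursion on [k]: [g j (f j)] for [j < k] takes fewer than
    [chi' <= chi] values, so these are bounded in [chi] by regularity. Taking
    [g j x >= x] makes [f] strictly increasing; letting [g] depend on the stage
    [j] as well serves to make [f] cofinal. *)
Lemma climbing chi' chi (g : chi' -> chi -> chi) (c : chi) :
  cardinal_le chi' chi ->
  exists f : chi' -> chi,
    (forall k, rc_le c (f k)) /\
    forall j k, rc_lt j k -> rc_lt (g j (f j)) (f k).
Proof.
move=> le_chi.
have /choice [ub ubP] : forall X : set chi, exists b : chi,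
    ~ ([set: chi] #<= X) -> rc_le c b /\ forall x, X x -> rc_lt x b.
  move=> X; have [large|/rc_bounded[b Xb]] := pselect ([set: chi] #<= X).
    by exists c.
  have [cb|bc] := rc_le_total c b; first by exists b.
  exists c => _; split=> [|x /Xb xb]; first exact: rc_le_refl.
  exact: rc_lt_le_trans xb bc.
pose F k (rec : forall j, rc_lt j k -> chi) :=
  ub [set x | exists j (jk : rc_lt j k), x = g j (rec j jk)].
pose f := Fix (@rc_lt_wf chi') (fun=> chi : Type) F.
have fE k : f k = ub [set x | exists2 j, rc_lt j k & x = g j (f j)].
  rewrite /f Fix_eq => [|j h h' eqh].
    by rewrite /F; congr ub; apply/seteqP; split=> x [j] => [[jk ->]|jk ->]; exists j.
  by congr F; apply: functional_extensionality_dep => l; apply/funext => lj.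
have small k : ~ ([set: chi] #<= [set x | exists2 j, rc_lt j k & x = g j (f j)]).
  move=> large; apply: (@rc_initial chi' k).
  apply: card_le_trans (card_le_trans le_chi large) _.
  apply: card_le_trans _ (card_image_le (fun j => g j (f j)) _).
  by apply: subset_card_le => x [j jk ->]; exists j.
exists f; split=> [k|j k jk]; rewrite (fE k); have [lec ltb] := ubP _ (small k) => //.
by apply: ltb; exists j.
Qed.

Lemma countable_or_gt chi : cardinal_le chi aleph0 \/ cardinal_lt aleph0 chi.
Proof.
have [|nle] := pselect (cardinal_le chi aleph0); [by left|right; split=> //].
by apply/infiniteP; apply: rc_infinite.
Qed.

(** Climbing above an enumeration [e] of [chi] by [chi'] makes [f] cofinal, so
    that a chain and its subchain along [f] have the same union. The bound [c]
    lets the subchain start as late as desired. *)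
Lemma cofinal_climbing chi' chi (c : chi) :
  cardinal_le chi' chi -> cardinal_le chi chi' ->
  exists f : chi' -> chi,
    [/\ forall k, rc_le c (f k),
        forall j k, rc_lt j k -> rc_lt (f j) (f k) &
        cofinal_in (@rc_le chi) (range f)].
Proof.
move=> le_chi /pfcard_geP ge_chi.
have [e e_surj] : exists e : chi' -> chi, forall x, exists j, e j = x.
  case: ge_chi => [/seteqP[/(_ c I)]//|[e]]; exists e => x.
  by have [j _ <-] := @surj _ _ _ _ e x I; exists j.
have /choice [mx mxP] : forall xy : chi * chi, exists m,
    rc_le xy.1 m /\ rc_le xy.2 m.
  move=> [x y]; case: (rc_le_total x y) => ?; [exists y|exists x];
  by split=> //=; apply: rc_le_refl.
have [f [cf fP]] := climbing (fun j x => mx (x, e j)) c le_chi.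
(* [f] exceeds [e j] from the stage after [j] on, and [chi'] has no last stage. *)
exists f; split=> // [j k /fP|x].
  by apply: rc_le_lt_trans; have [] := mxP (f j, e j).
have [j <-] := e_surj x; have [k jk] := rc_no_max j.
exists (f k) => //; apply/rc_ltW; apply: rc_le_lt_trans (fP _ _ jk).
by have [] := mxP (f j, e j).
Qed.

End RegularCardinals.

(** * Restriction of Galois types *)

Section GaloisTypes.
Context {V : Type} {tau : vocabulary} (K : abstract_class V tau).
Implicit Types (M N : structure V tau) (B : set V).

Lemma K_embedding_id N : K N -> @K_embedding V tau K N N id.
Proof.
move=> KN; split=> //; exists N, id; split=> //; last exact: ac_le_refl.
by split=> [|y]; [split|exists y].
Qed.

Lemma gtp_equiv_refl B N (a : N) : K N -> B `<=` N ->
  gtp_equiv K B (existT _ N a) (existT _ N a).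
Proof.
move=> KN BN; apply: Relation_Operators.t_step; split=> //.
by exists N, id, id; split=> //; exact: K_embedding_id.
Qed.

Lemma gtp_equiv_subset B0 B q q' : B0 `<=` B ->
  gtp_equiv K B q q' -> gtp_equiv K B0 q q'.
Proof.
move=> sB; elim=> [x y [Bx By [N [f1 [f2 [K1 K2 fix1 fix2 ff]]]]]|x y z _ xy _ yz].
  apply: Relation_Operators.t_step; split; [exact: subset_trans Bx|exact: subset_trans By|].
  by exists N, f1, f2; split=> // t /sB; [apply: fix1|apply: fix2].
exact: Relation_Operators.t_trans xy yz.
Qed.

(** The types over [B0] determined by a type over [B] are well defined, so equal
    types over [B] have equal restrictions. *)
Lemma gtp_restrictE B0 B N (a : N) : K N -> B0 `<=` B -> B `<=` N ->
  gtp_restrict K (gtp K B a) B0 = gtp K B0 a.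
Proof.
move=> KN sB BN; apply/seteqP; split=> q.
  move=> [q0 /(gtp_equiv_subset sB) aq0 q0q].
  exact: Relation_Operators.t_trans aq0 q0q.
by move=> aq; exists (existT _ N a) => //; apply: gtp_equiv_refl.
Qed.

Lemma ac_le_subset M N : ac_le K M N -> M `<=` N.
Proof.
move=> /ac_le_sub[f _ fE] x Mx; have := fE (SigSub (mem_set Mx)) => /= <-.
exact: set_valP.
Qed.

End GaloisTypes.

(** * Monotonicity of non-forking *)

Section NonForking.
Context {V : Type} {tau : vocabulary} (i : independence_relation V tau).
Let K := ir_class i.
Implicit Types (M N : structure V tau) (B : set V).

Lemma dnf_subset B0 B N (a : N) M : B0 `<=` B ->
  dnf i B N (gtp K B a) M -> dnf i B0 N (gtp K B0 a) M.
Proof.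
move=> sB [b eqab indb]; have [/ac_le_in[_ KN] _ BN _] := indep_dom indb.
exists b; last exact: indep_mono_sets indb.
by rewrite -(gtp_restrictE a KN sB BN) -(gtp_restrictE b KN sB BN) -eqab.
Qed.

Lemma dnf_base_mono B N p M0 M : ac_le K M0 M -> ac_le K M N ->
  (M : set V) `<=` B -> dnf i B N p M0 -> dnf i B N p M.
Proof.
by move=> M0M MN MB [a -> inda]; exists a => //; apply: indep_base_mono MB inda.
Qed.

End NonForking.

(** * Subchains and locality cardinals *)

Section Locality.
Context {V : Type} {tau : vocabulary} (i : independence_relation V tau).
Context (R : structure V tau -> structure V tau -> Prop).
Hypothesis R_stronger : forall M N, R M N -> ac_le (ir_class i) M N.
Let K := ir_class i.
Implicit Types (N : structure V tau) (chi : regular_cardinal).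

Lemma chain_le chi (Mc : chi -> structure V tau) j k :
  increasing_chain R Mc -> (forall l, K (Mc l)) -> rc_le j k ->
  ac_le K (Mc j) (Mc k).
Proof.
move=> incM KM /rc_le_eqVlt[->|jk]; first exact: ac_le_refl.
by apply: R_stronger; apply: incM.
Qed.

Lemma locality_data_comp chi' chi (f : chi' -> chi) Mc N (a : N) :
  (forall j k, rc_lt j k -> rc_lt (f j) (f k)) ->
  locality_data i R Mc N (gtp K (chain_union Mc) a) ->
  locality_data i R (Mc \o f) N (gtp K (chain_union (Mc \o f)) a).
Proof.
move=> incf [incM KN MN _]; split=> // [j k /incf|j|]; first exact: incM.
  exact: MN.
by exists a.
Qed.

Lemma chain_union_sub chi (Mc : chi -> structure V tau) j :
  (Mc j : set V) `<=` chain_union Mc.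
Proof. by move=> x Mx; exists j. Qed.

Lemma chain_union_subset chi (Mc : chi -> structure V tau) N :
  (forall j, ac_le K (Mc j) N) -> chain_union Mc `<=` N.
Proof. by move=> MN x [j _ /(ac_le_subset (MN j))]. Qed.

Lemma locality_restrictE chi (Mc : chi -> structure V tau) N (a : N) j :
  K N -> (forall k, ac_le K (Mc k) N) ->
  gtp_restrict K (gtp K (chain_union Mc) a) (Mc j) = gtp K (Mc j) a.
Proof.
move=> KN MN; apply: gtp_restrictE => //; first exact: chain_union_sub.
exact: chain_union_subset.
Qed.

Lemma ukappa_sub_wk : ukappa i R `<=` ukappa_wk i R.
Proof.
move=> chi kchi Mc N p data; have [j dj] := kchi Mc N p data.
case: data => incM KN MN [a Ep]; rewrite {}Ep in dj *.
have [k jk] := rc_succ j; exists j, k; split=> //.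
by rewrite locality_restrictE //; apply: dnf_subset dj; apply: chain_union_sub.
Qed.

(** The subchain given by [f] has a successor pair [j < k] at which the type over
    [Mc (f k)] does not fork over [Mc (f j)]; since [g j <= f k], this passes to
    [Mc (g j)]. *)
Lemma wk_subchain chi' chi (f g : chi' -> chi) Mc N (a : N) :
  ukappa_wk i R chi' ->
  locality_data i R Mc N (gtp K (chain_union Mc) a) ->
  (forall j k, rc_lt j k -> rc_lt (f j) (f k)) ->
  (forall j k, rc_lt j k -> rc_le (g j) (f k)) ->
  exists j, dnf i (Mc (g j)) N (gtp K (Mc (g j)) a) (Mc (f j)).
Proof.
move=> wk data incf gf; case: (data) => incM KN MN _.
have [j [k [[jk _] djk]]] := wk _ _ _ (locality_data_comp incf data).
exists j; move: djk; rewrite locality_restrictE //; last by move=> l; apply: MN.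
apply: dnf_subset; apply: ac_le_subset; apply: chain_le incM _ (gf _ _ jk).
by move=> l; have [] := ac_le_in (MN l).
Qed.

Lemma ukappa_wk_end_segment : end_segment (ukappa_wk i R).
Proof.
move=> chi0 chi wk [le_chi _] Mc N p data.
case: (data) => incM KN MN [a Ep]; rewrite {}Ep in data *.
have [c _] := rc_inhabited chi.
have [f [_ incf]] := climbing (fun=> id) c le_chi.
have /choice [s sP] := @rc_succ chi.
have [|j dj] := wk_subchain (g := s \o f) wk data incf.
  by move=> j k /incf; have [_] := sP (f j); apply.
by exists (f j), (s (f j)); split=> //; rewrite locality_restrictE.
Qed.

(** Continuity concerns the first model of a chain, so it is applied to a cofinal
    subchain starting above [c], whose first model inherits non-forking from
    [Mc c] by base monotonicity. If [chi] is uncountable, the subchain is indexed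
    by [chi] itself; otherwise by [aleph0], of which [chi] is another
    presentation. *)
Lemma cont_eventual_dnf chi Mc N (a : N) (c : chi) :
  cont_from i R aleph0 ->
  locality_data i R Mc N (gtp K (chain_union Mc) a) ->
  (forall j, rc_le c j -> dnf i (Mc j) N (gtp K (Mc j) a) (Mc c)) ->
  exists j, dnf i (chain_union Mc) N (gtp K (chain_union Mc) a) (Mc j).
Proof.
move=> [cont0 contS] data dnfc; case: (data) => incM KN MN _.
have KM l : K (Mc l) by have [] := ac_le_in (MN l).
have [chi' [cont' le1 le2]] : exists chi',
    [/\ ukappa_cont i R chi', cardinal_le chi' chi & cardinal_le chi chi'].
  have [le_chi|gt_chi] := countable_or_gt chi.
    by exists aleph0; split=> //; apply/infiniteP; apply: rc_infinite.
  by exists chi; split; [apply: contS|apply: card_lexx|apply: card_lexx].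
have [f [cf incf coff]] := cofinal_climbing c le1 le2.
have [zero zeroP] : exists z : chi', forall x, rc_le z x.
  have [|z _ minz] := @rc_min chi' setT; last by exists z => x; apply: minz.
  by have [z _] := rc_inhabited chi'; exists z.
have eqU : chain_union (Mc \o f) = chain_union Mc.
  apply/seteqP; split=> x [j _ Mx]; first by exists (f j).
  have [_ [k _ <-] jk] := coff j; exists k => //.
  exact: ac_le_subset (chain_le incM KM jk) _ Mx.
exists (f zero); rewrite -eqU.
apply: (cont' _ _ _ _ _ zeroP); first exact: locality_data_comp.
move=> j; rewrite locality_restrictE //; last by move=> l; apply: MN.
have zj : rc_le (f zero) (f j).
  by case: (rc_le_eqVlt (zeroP j)) => [->|/incf/rc_ltW//]; apply: rc_le_refl.
apply: dnf_base_mono (dnfc _ (cf j)); [exact: chain_le|exact: MN|].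
exact: ac_le_subset (chain_le incM KM zj).
Qed.

Lemma wk_sub_ukappa : cont_from i R aleph0 -> ukappa_wk i R `<=` ukappa i R.
Proof.
move=> cont chi wk Mc N p data.
case: (data) => incM KN MN [a Ep]; rewrite {}Ep in data *.
apply: contrapT => forks.
have /choice [g gP] : forall c : chi, exists j,
    rc_le c j /\ ~ dnf i (Mc j) N (gtp K (Mc j) a) (Mc c).
  move=> c; apply: contrapT => nog; apply: forks.
  apply: (cont_eventual_dnf cont data (c := c)) => j cj.
  by apply: contrapT => nd; apply: nog; exists j.
have [c _] := rc_inhabited chi.
have [f [_ gf]] := climbing (fun=> g) c (card_lexx [set: chi]).
have [||j] := wk_subchain (f := f) (g := g \o f) wk data.
- by move=> j k /gf; apply: rc_le_lt_trans; have [] := gP (f j).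
- by move=> j k /gf/rc_ltW.
by have [] := gP (f j).
Qed.

End Locality.

Theorem corollary2p8 (V : Type) (tau : vocabulary)
    (i : independence_relation V tau)
    (R : structure V tau -> structure V tau -> Prop)
    (R_porder : strict_or_weak_porder i R)
    (R_stronger : forall M N : structure V tau, R M N -> ac_le (ir_class i) M N)
    (kappa_cont_aleph0 : kappa_cont_is i R aleph0) :
  ukappa i R = ukappa_wk i R /\
  end_segment (ukappa i R) /\
  end_segment (ukappa_wk i R).
Proof.
have [cont _] := kappa_cont_aleph0.
have -> : ukappa i R = ukappa_wk i R.
  by apply/seteqP; split; [apply: ukappa_sub_wk|apply: wk_sub_ukappa].
by have endwk := ukappa_wk_end_segment R_stronger.
Qed.
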